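(* Let $\mu_n(f,g)=\frac{1}{n!}\frac{\partial^n f}{\partial x^n}\frac{\partial^n g}{\partial y^n}$ for $n\in\mathbb N$ and $f,g\in\mathbb R[x,y]$, and let $f\star g=\sum_{n\in\mathbb N}\mu_n(f,g)t^n$ be the Moyal-Weyl star-product. Every morphism $\alpha:\mathbb R[x,y]\to\mathbb R[x,y]$ which satisfies $\alpha\circ\mu_i=\mu_i\circ\alpha^{\otimes 2}$ for all $i\in\mathbb N$ and gives $(\mathbb R[x,y],\ \star_\alpha=\alpha\circ\star,\ \alpha)$ a structure of Hom-associative algebra is of the form $$\alpha(x)=ax+b\quad\text{and}\quad \alpha(y)=\frac1a\,y+c,\qquad\text{where } a,b,c\in\mathbb R,\ a\neq0.$$
   Context: $\mathbb N$ includes $0$; $\mu_0$ is the usual product of polynomials. A morphism $\alpha$ is a unital ($\alpha(1)=1$) $\mathbb R$-algebra endomorphism of $\mathbb R[x,y]$. The product $\star$ takes values in formal power series in $t$ and is extended, together with $\alpha$, $\mathbb R[[t]]$-linearly to $\mathbb R[x,y][[t]]$; $f\star_\alpha g=\sum_n\alpha(\mu_n(f,g))t^n$. A triple $(A,\mu,\alpha)$ with $\mu$ bilinear and $\alpha$ linear is a Hom-associative algebra if $\mu(\mu(f,g),\alpha(h))=\mu(\alpha(f),\mu(g,h))$ for all $f,g,h$. *)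

(* Defs.v *)
From HB Require Import structures.
From mathcomp Require Import all_boot all_order all_algebra.
From mathcomp Require Import boolp functions reals.
From mathcomp Require Import mpoly.

Set Implicit Arguments.
Unset Strict Implicit.
Unset Printing Implicit Defensive.

Import GRing.Theory.
Local Open Scope ring_scope.

(* fps V is V[[t]]: the series \sum_n F_n t^n is the function n |-> F_n. It is
   an alias of nat -> V because the library's product on nat -> V is pointwise. *)
Definition fps (V : Type) : Type := nat -> V.

HB.instance Definition _ (V : zmodType) := GRing.Zmodule.copy (fps V) (nat -> V).

Lemma fpsP (V : Type) (F G : fps V) : (forall n, F n = G n) -> F = G.
Proof. exact: funext. Qed.

Lemma fpsD (V : zmodType) (F G : fps V) n : (F + G) n = F n + G n.
Proof. by []. Qed.

(* Both sides sum H i j k over the triples with i + j + k = n. *)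
Lemma sum_triples (V : nmodType) (H : nat -> nat -> nat -> V) n :
  \sum_(i < n.+1) \sum_(j < (n - i).+1) H i j (n - i - j)%N
  = \sum_(m < n.+1) \sum_(i < m.+1) H i (m - i)%N (n - m)%N.
Proof.
pose T i j := H i (j - i)%N (n - j)%N.
transitivity (\sum_(i < n.+1) \sum_(m < n.+1 | (i <= m)%N) T i m).
  apply: eq_bigr => i _; have le_in : (i <= n)%N by rewrite -ltnS.
  transitivity (\sum_(0 + i <= m < n.+1) T i m).
    rewrite big_addn subSn // big_mkord.
    by apply: eq_bigr => j _; rewrite /T addnK subnDA subnAC.
  by rewrite add0n big_geq_mkord.
rewrite (exchange_big_dep xpredT) //=; apply: eq_bigr => m _.
by rewrite [RHS](big_ord_widen n.+1 (fun i => T i m)) ?ltn_ord.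
Qed.

Definition fps_one (K : comNzRingType) : fps K := fun n => (n == 0%N)%:R.

Definition fps_mul (K : comNzRingType) (c d : fps K) : fps K :=
  fun n => \sum_(i < n.+1) c i * d (n - i)%N.

Definition fps_scale (K : comNzRingType) (V : lmodType K) (c : fps K) (F : fps V)
  : fps V := fun n => \sum_(i < n.+1) c i *: F (n - i)%N.

Section FpsModule.
Variables (K : comNzRingType) (V : lmodType K).
Implicit Types (c d : fps K) (F G : fps V).

Lemma fps_scaleA c d F : fps_scale c (fps_scale d F) = fps_scale (fps_mul c d) F.
Proof.
apply: fpsP => n; rewrite /fps_scale /fps_mul.
under eq_bigr do rewrite scaler_sumr.
under [RHS]eq_bigr do rewrite scaler_suml.
rewrite (sum_triples (fun i j k => c i *: (d j *: F k))).
by apply: eq_bigr => m _; apply: eq_bigr => i _; rewrite scalerA.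
Qed.

Lemma fps_scale1 F : fps_scale (fps_one K) F = F.
Proof.
apply: fpsP => n; rewrite /fps_scale big_ord_recl scale1r subn0.
by rewrite big1 ?addr0 // => i _; rewrite scale0r.
Qed.

Lemma fps_scaleDr c F G : fps_scale c (F + G) = fps_scale c F + fps_scale c G.
Proof.
apply: fpsP => n; rewrite /fps_scale fpsD -big_split /=.
by apply: eq_bigr => i _; rewrite fpsD scalerDr.
Qed.

Lemma fps_scaleDl c d F : fps_scale (c + d) F = fps_scale c F + fps_scale d F.
Proof.
apply: fpsP => n; rewrite /fps_scale fpsD -big_split /=.
by apply: eq_bigr => i _; rewrite fpsD scalerDl.
Qed.

End FpsModule.

Section FpsRing.
Variable K : comNzRingType.
Implicit Types c d e : fps K.

Let mulA : associative (@fps_mul K).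
Proof. by move=> c d e; exact: (@fps_scaleA K K^o c d e). Qed.

Let mulC : commutative (@fps_mul K).
Proof.
move=> c d; apply: fpsP => n; rewrite /fps_mul (reindex_inj rev_ord_inj) /=.
by apply: eq_bigr => i _; rewrite subSS subKn 1?mulrC // -ltnS; exact: ltn_ord.
Qed.

Let mul1 : left_id (fps_one K) (@fps_mul K).
Proof. by move=> c; exact: (@fps_scale1 K K^o c). Qed.

Let mulDl : left_distributive (@fps_mul K) +%R.
Proof. by move=> c d e; exact: (@fps_scaleDl K K^o c d e). Qed.

Let one_neq0 : fps_one K != 0.
Proof. by apply/eqP => /(congr1 (@^~ 0%N))/eqP; rewrite oner_eq0. Qed.

HB.instance Definition _ :=
  GRing.Zmodule_isComNzRing.Build (fps K) mulA mulC mul1 mulDl one_neq0.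

End FpsRing.

HB.instance Definition _ (K : comNzRingType) (V : lmodType K) :=
  GRing.Zmodule_isLmodule.Build (fps K) (fps V) (@fps_scaleA K V)
    (@fps_scale1 K V) (@fps_scaleDr K V)
    (fun F c d => @fps_scaleDl K V c d F).

Definition fps_map (V W : Type) (phi : V -> W) (F : fps V) : fps W :=
  fun n => phi (F n).

(* A product V x V -> V[[t]], f, g |-> \sum_k nu f g k t^k, extended to V[[t]] by
   (\sum_i F_i t^i) (\sum_j G_j t^j) = \sum_(i,j,k) nu F_i G_j k t^(i + j + k). *)
Definition fps_extend (V : zmodType) (nu : V -> V -> fps V) (F G : fps V) : fps V :=
  fun n => \sum_(i < n.+1) \sum_(j < (n - i).+1) nu (F i) (G j) (n - i - j)%N.

Definition hom_associative (K : nzRingType) (A : lmodType K)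
    (mu : A -> A -> A) (alpha : A -> A) : Prop :=
  [/\ bilinear_for *:%R *:%R mu, linear alpha &
      forall f g h : A, mu (mu f g) (alpha h) = mu (alpha f) (mu g h)].

Section MoyalWeyl.
Variable K : fieldType.
Implicit Types (f g : {mpoly K[2]}) (F G : fps {mpoly K[2]}).

(* The variables x and y are 'X_0 and 'X_1. *)
Definition moyal_mu (n : nat) f g : {mpoly K[2]} :=
  (n`!%:R)^-1 *: (f^`M(0, n) * g^`M(1, n)).

Definition moyal_weyl f g : fps {mpoly K[2]} := fun n => moyal_mu n f g.

Definition moyal_star F G : fps {mpoly K[2]} := fps_extend moyal_weyl F G.

Definition moyal_star_twist (alpha : {mpoly K[2]} -> {mpoly K[2]}) F G :
  fps {mpoly K[2]} := fps_map alpha (moyal_star F G).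

End MoyalWeyl.

(* Main.v *)
Require Import Defs.
From HB Require Import structures.
From mathcomp Require Import all_boot all_order all_algebra.
From mathcomp Require Import boolp functions reals.
From mathcomp Require Import mpoly.

Import GRing.Theory Num.Theory.

Local Open Scope ring_scope.

(** Compatibility with [mu_1], evaluated on pairs of variables, already
    determines [alpha]. Write [X = alpha x] and [Y = alpha y]. From
    [mu_1(x, y) = 1] and [mu_1(x, x) = mu_1(y, y) = 0] one gets [X_x Y_y = 1],
    [X_x X_y = 0] and [Y_x Y_y = 0]. The first identity makes [X_x] and [Y_y]
    mutually inverse nonzero constants, so [X_y = Y_x = 0], and in
    characteristic [0] the partial derivatives determine [X] and [Y] up to
    additive constants. *)

(** The coefficient of [p] at [m], multiplied by [m i], is a coefficient of the [i]-th derivative.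
    In characteristic zero it can be nonzero only if every [m i] is zero. *)
Lemma mderiv_eq0_mpolyC (n : nat) (K : numDomainType) (p : {mpoly K[n]}) :
  (forall i, p^`M(i) = 0) -> p = (p@_0)%:MP.
Proof.
move=> dp0; apply/mpolyP => m; rewrite mcoeffC.
have [->|m0] := eqVneq m 0%MM; first by rewrite mulr1.
rewrite mulr0.
have [i mi] : exists i, (0 < m i)%N.
  apply/existsP; apply: contraNT m0 => /existsPn m0.
  by apply/eqP/mnmP => i; apply/eqP; rewrite mnm0E -leqn0 leqNgt.
have := mcoeff_deriv i (m - U_(i))%MM p.
rewrite dp0 mcoeff0 submK; last first.
  by apply/mnm_lepP => j; rewrite mnm1E; case: eqP => [<-|].
by move=> /esym/eqP; rewrite mulrn_eq0 /= => /eqP.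
Qed.

Lemma mderiv_var (n : nat) (K : nzRingType) (i j : 'I_n) :
  ('X_j : {mpoly K[n]})^`M(i) = (j == i)%:R.
Proof.
rewrite mderivX mnm1E; have [->|_] := eqVneq; last by rewrite scale0r.
by rewrite -[X in (X - _)%MM]add0m addmK mpolyX0 scale1r.
Qed.

(** Subtracting [a *: 'X_i] kills every partial derivative, so a constant remains. *)
Lemma affine_of_mderiv (n : nat) (K : numDomainType) (p : {mpoly K[n]})
    (i : 'I_n) (a : K) :
  p^`M(i) = a%:MP -> (forall j, j != i -> p^`M(j) = 0) ->
  exists b, p = a *: 'X_i + b%:MP.
Proof.
move=> pi pj; exists ((p - a *: 'X_i)@_0).
rewrite -mderiv_eq0_mpolyC ?subrKC // => j.
rewrite mderivB mderivZ mderiv_var eq_sym.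
have [->|/pj ->] := eqVneq j i; last by rewrite scaler0 subr0.
by rewrite pi alg_mpolyC subrr.
Qed.

Lemma mpoly_mul_eq1 (n : nat) (K : fieldType) (p q : {mpoly K[n]}) :
  p * q = 1 -> exists2 a : K, a != 0 & p = a%:MP /\ q = a^-1%:MP.
Proof.
move=> pq1; have /andP[/eqP p_const] : p \in @mpoly_unit n K.
  by apply: (@mpoly_intro_unit _ _ p q); rewrite mulrC.
rewrite unitfE; set a := p@_0 in p_const * => a0; exists a => //; split=> //.
(* Here [q = a^-1 * a * q = a^-1 * (p * q)]. *)
by rewrite -[q]mul1r -[1]mpolyC1 -(mulVf a0) mpolyCM -p_const -mulrA pq1 mulr1.
Qed.

Lemma moyal_mu1 (K : fieldType) (f g : {mpoly K[2]}) :
  moyal_mu 1 f g = f^`M(0) * g^`M(1).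
Proof. by rewrite /moyal_mu invr1 scale1r !mderivSn !mderivn0. Qed.

Theorem proposition4p9 (R : realType)
    (alpha : {lrmorphism {mpoly R[2]} -> {mpoly R[2]}})
    (alpha_mu : forall (i : nat) (f g : {mpoly R[2]}),
       alpha (moyal_mu i f g) = moyal_mu i (alpha f) (alpha g))
    (alpha_hom : hom_associative (K := fps R)
       (moyal_star_twist alpha) (fps_map alpha)) :
  exists a b c : R,
    [/\ a != 0,
        alpha 'X_0 = a *: 'X_0 + b%:MP &
        alpha 'X_1 = a^-1 *: 'X_1 + c%:MP].
Proof.
have mu1 (i j : 'I_2) :
    (alpha 'X_i)^`M(0) * (alpha 'X_j)^`M(1) = ((i == 0) && (j == 1))%:R.
  (* On variables [moyal_mu 1] is 0 or 1, which the unital [alpha] fixes. *)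
  by rewrite -moyal_mu1 -alpha_mu moyal_mu1 !mderiv_var -natrM mulnb rmorph_nat.
have [a a0 [Xx Yy]] := mpoly_mul_eq1 _ _ _ _ (mu1 0 1).
have Xy : (alpha 'X_0)^`M(1) = 0.
  (* The nonzero constant [X_x] cancels from [X_x X_y = 0]. *)
  have /eqP := mu1 0 0; rewrite Xx mulf_eq0 mpolyC_eq0 (negPf a0).
  by move=> /eqP.
have Yx : (alpha 'X_1)^`M(0) = 0.
  have /eqP := mu1 1 1; rewrite Yy mulf_eq0 mpolyC_eq0 invr_eq0 (negPf a0) orbF.
  by move=> /eqP.
have ord2 (j : 'I_2) : j = 0 \/ j = 1.
  by case: j => [[|[|//]] lt_j2]; [left | right]; apply: val_inj.
have [b Xb] : exists b, alpha 'X_0 = a *: 'X_0 + b%:MP.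
  by apply: (affine_of_mderiv _ _ _ _ _ Xx) => j; case: (ord2 j) => ->.
have [c Yc] : exists c, alpha 'X_1 = a^-1 *: 'X_1 + c%:MP.
  by apply: (affine_of_mderiv _ _ _ _ _ Yy) => j; case: (ord2 j) => ->.
by exists a, b, c.
Qed.
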